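(* Let $X$ be a discrete-time Markov chain with state space $\{0,\dots,d\}$, arbitrary initial distribution $m_0$ (a row vector) and transition matrix $P$, such that state $d$ is absorbing and accessible from each other state. Let $\theta_0,\dots,\theta_{d-1}$ be the $d$ non-unit eigenvalues of $P$ (in fixed but arbitrary order), let $\theta_d=1$, and let $\widehat P$, $\Lambda$ and $a_k$ be defined from $m_0$, $P$ and the $\theta_i$'s as in the context. Then the time $T$ of absorption of $X$ in state $d$ satisfies $$ \mathbf{P}(T\le t)=\sum_{k=0}^d a_k\sum_{j=k}^d \widehat P^{\,t}(0,j),\qquad t=0,1,2,\dots, $$ and has probability generating function $$ \mathbf{E}\,u^T=\sum_{k=0}^d a_k\prod_{j=0}^{k-1}\left[\frac{(1-\theta_j)u}{1-\theta_j u}\right]. $$ In particular, if the eigenvalues $\theta_i$ are all nonnegative real numbers (here listed in nondecreasing order) and the spectral polynomials $(P-\theta_0 I)\cdots(P-\theta_{k-1}I)$, $k=0,\dots,d$, are all (entrywise) nonnegative matrices, then $T$ is distributed as the mixture $\sum_{k=0}^d a_k\,\mathcal{G}(\theta_0,\dots,\theta_{k-1})$ of the convolution distributions $\mathcal{G}(\theta_0,\dots,\theta_{k-1})$, $k=0,\dots,d$.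
   Context: All square matrices have rows and columns indexed by $\{0,\dots,d\}$; $I$ is the identity matrix. Eigenvalues are complex and listed with algebraic multiplicity. $\widehat P$ is the bidiagonal matrix with entries $\hat p_{ii}=\theta_i$, $\hat p_{i,i+1}=1-\theta_i$, and $\hat p_{ij}=0$ otherwise, for $i,j=0,\dots,d$. The normalized spectral polynomials are $$Q_k=(1-\theta_0)^{-1}\cdots(1-\theta_{k-1})^{-1}(P-\theta_0 I)\cdots(P-\theta_{k-1}I),\quad k=0,\dots,d,\qquad Q_0=I.$$ $\Lambda$ is the matrix whose $i$th row is $\lambda_i=m_0Q_i$, $i=0,\dots,d$. With the conventions $\Lambda(-1,d):=0$ and $\Lambda(d+1,d):=1$, set $a_k:=\Lambda(k,d)-\Lambda(k-1,d)$ for $k=0,\dots,d+1$. Empty sums are $0$ and empty products are $1$. Probability generating functions are considered for $|u|<1$. When the $\theta_i$ are real and nonnegative, $\mathcal{G}(\theta_0,\dots,\theta_{k-1})$ denotes the convolution of geometric distributions on $\{1,2,\dots\}$ with respective success probabilities $1-\theta_0,\dots,1-\theta_{k-1}$; for $k=0$ it is the distribution concentrated at $0$. *)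

(* Defs.v *)
From HB Require Import structures.
From mathcomp Require Import all_boot all_order all_algebra.
From mathcomp Require Import all_classical all_reals all_analysis.
From mathcomp Require Import complex.

Set Implicit Arguments.
Unset Strict Implicit.
Unset Printing Implicit Defensive.

Import Order.TTheory GRing.Theory Num.Theory.
Import numFieldNormedType.Exports.

Local Open Scope classical_set_scope.
Local Open Scope ring_scope.
Local Open Scope complex_scope.

Section MarkovChain.
Context (R : realType) (d : nat).

Definition stochastic (P : 'M[R]_d.+1) : Prop :=
  (forall i j, 0 <= P i j) /\ (forall i, \sum_j P i j = 1).

Definition absorbing (P : 'M[R]_d.+1) (i : 'I_d.+1) : Prop := P i i = 1.

Definition accessible (P : 'M[R]_d.+1) (i j : 'I_d.+1) : Prop :=
  exists n : nat, 0 < (P ^+ n) i j.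

Context (dsp : measure_display) (Omega : measurableType dsp)
        (Pr : probability Omega R).

Definition cond_prob (A B : set Omega) : R :=
  fine (Pr (A `&` B)) / fine (Pr B).

(* The state space carries the discrete sigma-algebra, so measurability of
   each X n is measurability of the fibres.  The Markov property conditions on
   the whole history X_0, ..., X_n, whenever it has positive probability. *)
Record markov_chain (X : nat -> Omega -> 'I_d.+1) (m0 : 'rV[R]_d.+1)
    (P : 'M[R]_d.+1) : Prop := MarkovChain {
  mc_stochastic : stochastic P ;
  mc_measurable : forall n i, measurable [set w | X n w = i] ;
  mc_initial : forall i, Pr [set w | X 0%N w = i] = (m0 ord0 i)%:E ;
  mc_markov : forall (n : nat) (h : nat -> 'I_d.+1) (j : 'I_d.+1),
    let history := [set w | forall k, (k <= n)%N -> X k w = h k] in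
    (0 < Pr history)%E ->
    cond_prob [set w | X n.+1 w = j] history = P (h n) j }.

(* [None] stands for an infinite time. *)
Definition hitting_time (X : nat -> Omega -> 'I_d.+1) (e : 'I_d.+1)
    (w : Omega) : option nat :=
  match pselect (exists n, X n w == e) with
  | left hits => Some (ex_minn hits)
  | right _ => None
  end.

Definition time_le (s : option nat) (t : nat) : Prop :=
  if s is Some n then (n <= t)%N else False.

(* u ^ oo = 0, as |u| < 1. *)
Definition time_pow (u : R[i]) (s : option nat) : R[i] :=
  if s is Some n then u ^+ n else 0.

Definition cexpectation (Z : Omega -> R[i]) : R[i] :=
  fine ('E_Pr[fun w => complex.Re (Z w)])%E +i*
  fine ('E_Pr[fun w => complex.Im (Z w)])%E.

Definition has_pmf (T : Omega -> option nat) (f : nat -> R) : Prop :=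
  (forall n, Pr [set w | T w = Some n] = (f n)%:E) /\
  Pr [set w | T w = None] = 0%E.

End MarkovChain.

Section Spectral.
Context (R : realType) (d : nat).
Local Notation C := R[i].
Local Notation toC := (@map_mx R C (real_complex R) _ _).

(* theta restricted to indices < d lists the eigenvalues of P other than 1,
   each as often as its algebraic multiplicity, and theta_d = 1. *)
Definition nonunit_eigenvalues (P : 'M[R]_d.+1) (theta : 'I_d.+1 -> C) : Prop :=
  [/\ forall i : 'I_d.+1, (i < d)%N -> theta i != 1,
      forall z : C, z != 1 ->
        #|[set i : 'I_d.+1 | (i < d)%N && (theta i == z)]%SET|
        = mup z (char_poly (toC P))
    & theta ord_max = 1].

Definition Phat (theta : 'I_d.+1 -> C) : 'M[C]_d.+1 :=
  \matrix_(i, j) if j == i then theta i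
                 else if j == i.+1 :> nat then 1 - theta i
                 else 0.

Definition spectral_poly (P : 'M[R]_d.+1) (theta : 'I_d.+1 -> C) (k : nat) :
    'M[C]_d.+1 :=
  \prod_(j < d.+1 | (j < k)%N) (toC P - (theta j)%:M).

Definition Q (P : 'M[R]_d.+1) (theta : 'I_d.+1 -> C) (k : nat) : 'M[C]_d.+1 :=
  (\prod_(j < d.+1 | (j < k)%N) (1 - theta j)^-1) *: spectral_poly P theta k.

Definition Lambda (m0 : 'rV[R]_d.+1) (P : 'M[R]_d.+1) (theta : 'I_d.+1 -> C) :
    'M[C]_d.+1 :=
  \matrix_(i < d.+1) (toC m0 *m Q P theta i).

(* The last column of Lambda, shifted by one and extended on both sides:
   [Lambda_last s] is Lambda(s - 1, d) for s = 0, ..., d + 2. *)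
Definition Lambda_last (m0 : 'rV[R]_d.+1) (P : 'M[R]_d.+1)
    (theta : 'I_d.+1 -> C) (s : nat) : C :=
  match s with
  | 0%N => 0
  | k.+1 => if (k <= d)%N then Lambda m0 P theta (inord k) ord_max else 1
  end.

Definition a_coef (m0 : 'rV[R]_d.+1) (P : 'M[R]_d.+1) (theta : 'I_d.+1 -> C)
    (k : nat) : C :=
  Lambda_last m0 P theta k.+1 - Lambda_last m0 P theta k.

Definition mx_nonneg (A : 'M[C]_d.+1) : Prop := forall i j, 0 <= A i j.

End Spectral.

Section Geometric.
Context (R : realType).

Definition dirac0_pmf : nat -> R := fun n => (n == 0%N)%:R.

Definition geometric_pmf (p : R) : nat -> R :=
  fun n => if n is n'.+1 then p * (1 - p) ^+ n' else 0.

Definition conv_pmf (f g : nat -> R) : nat -> R :=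
  fun n => \sum_(i < n.+1) f i * g (n - i)%N.

(* Meaningful when theta is real-valued; theta_j is then its own real part. *)
Definition conv_geometric_pmf (d : nat) (theta : 'I_d.+1 -> R[i]) (k : nat) :
    nat -> R :=
  \big[conv_pmf/dirac0_pmf]_(j < d.+1 | (j < k)%N)
     geometric_pmf (1 - complex.Re (theta j)).

Definition mixture_pmf (d : nat) (c : 'I_d.+1 -> R) (f : 'I_d.+1 -> nat -> R) :
    nat -> R :=
  fun n => \sum_k c k * f k n.

End Geometric.

(* Main.v *)
From HB Require Import structures.
Require Import Defs.
From mathcomp Require Import all_boot all_order all_algebra.
From mathcomp Require Import all_classical all_reals all_analysis.
From mathcomp Require Import complex ring.

(** Write L_k = m0 Q_k for the rows of Lambda. Splitting P = theta_k + (P -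
    theta_k) gives L_k P = theta_k L_k + (1 - theta_k) L_{k+1} for k < d, and
    Cayley-Hamilton gives L_d P = L_d, because theta lists the roots of the
    characteristic polynomial of P. So Lambda P = Phat Lambda: Lambda
    intertwines the chain with the (formal) pure-birth chain of matrix Phat,
    and m0 P^t is the combination of the rows L_j with the coefficients
    Phat^t(0, j) (duality_exp). As d is absorbing, P(T <= t) is the last entry
    of m0 P^t (absorption_cdf). A summation by parts (sum_tail_duality)
    replaces the last entries of the rows L_j by their increments a_k and
    Phat^t(0, j) by its tail sums, which is the first formula. The tail sum
    birth_cdf k t is the probability that the pure-birth chain has reached
    level k by time t.

    For the generating function, E u^T is the sum of the series of u^n P(T =
    n), that is, (1 - u) times the last entry of m0 (1 - u P)^-1. The
    intertwining again gives this row explicitly: its coefficient on L_k is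
    that of the first row of (1 - u Phat)^-1, namely birth_pgf u k / (1 -
    theta_k u), where the denominators are nonzero since the eigenvalues of a
    stochastic matrix have modulus at most 1. The partial sums of the series
    telescope (pgf_partial_sum), leaving a remainder of order |u|^N because P
    contracts the l1 norm of rows; the truncated expectation has an error of
    the same order (cexpectation_pow_approx), so no limit theorem for
    integrals is involved.

    If the spectrum and the spectral polynomials are nonnegative, the L_k are
    probability vectors. Their mass at d increases with k (L_ord_max_le), so
    a_k >= 0, and L_d, being invariant, is concentrated at d (L_last_ord_max),
    so the a_k sum to 1. The birth times then are sums of independent
    geometric times: birth_cdf satisfies the recursion of the distribution
    functions of the convolutions (birth_cdf_conv_geometric). Finally T is
    almost surely finite because the birth times have finite expectations
    (birth_survival_sum_bound). *)

Set Implicit Arguments.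
Unset Strict Implicit.
Unset Printing Implicit Defensive.

Import Order.TTheory GRing.Theory Num.Theory.
Import numFieldNormedType.Exports.

Local Open Scope classical_set_scope.
Local Open Scope ring_scope.
Local Open Scope complex_scope.

(** * Initial segments of big operators, and stochastic matrices *)

(** Products over the initial segment {j < k} of a fixed ordinal range are how
    the spectral polynomials, the birth-time generating functions and the
    convolutions are all indexed; this is the recursion on k they share. The
    operation is only assumed associative, since matrices do not commute. *)
Lemma big_ord_ltS (T : Type) (idx : T) (op : Monoid.law idx) (d k : nat)
    (F : 'I_d.+1 -> T) : (k <= d)%N ->
  \big[op/idx]_(j < d.+1 | (j < k.+1)%N) F j =
  op (\big[op/idx]_(j < d.+1 | (j < k)%N) F j) (F (inord k)).
Proof.
move=> le_kd; have lt_kd : (k < d.+1)%N by [].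
rewrite (big_ord_narrow lt_kd) (big_ord_narrow (ltnW lt_kd)).
rewrite big_ord_recr /=; congr (op _ (F _)).
  by apply: eq_bigr => i _; congr (F _); apply: val_inj.
by apply: val_inj; rewrite /= inordK.
Qed.

Lemma lin_mxE (K : pzRingType) (m n : nat) (a b : K) (X Y : 'M[K]_(m, n)) i j :
  (a *: X + b *: Y) i j = a * X i j + b * Y i j.
Proof. by rewrite !mxE. Qed.

Lemma absorbing_row (R : realType) (d : nat) (P : 'M[R]_d.+1) (e j : 'I_d.+1) :
  stochastic P -> absorbing P e -> P e j = (j == e)%:R.
Proof.
case=> P_ge0 P_sum P_abs; case: eqP => [->//|/eqP j_neq].
have := P_sum e; rewrite (bigD1 e) //= P_abs.
by move/(canRL (addKr _)); rewrite addNr => /psumr_eq0P ->.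
Qed.

Section RowVectors.
Context (K : numDomainType) (n : nat) (A : 'M[K]_n).
Hypotheses (A_ge0 : forall i j, 0 <= A i j) (A_sum : forall i, \sum_j A i j = 1).

Lemma stochastic_row_sum m (x : 'M[K]_(m, n)) i :
  \sum_j (x *m A) i j = \sum_j x i j.
Proof.
under eq_bigr do rewrite mxE.
rewrite exchange_big /=; apply: eq_bigr => l _.
by rewrite -mulr_sumr A_sum mulr1.
Qed.

(** A stochastic matrix acting on rows contracts the l1 norm, also on complex
    rows. It bounds the eigenvalues and, later, all the powers of P. *)
Lemma stochastic_l1_le (x : 'rV[K]_n) :
  \sum_j `|(x *m A) 0 j| <= \sum_j `|x 0 j|.
Proof.
have -> : \sum_j `|x 0 j| = \sum_j \sum_l `|x 0 l| * A l j.
  rewrite exchange_big /=; apply: eq_bigr => l _.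
  by rewrite -mulr_sumr A_sum mulr1.
apply: ler_sum => j _; rewrite mxE (le_trans (ler_norm_sum _ _ _)) //.
by apply: ler_sum => l _; rewrite normrM (ger0_norm (A_ge0 _ _)).
Qed.

End RowVectors.

Lemma stochastic_eigenvalue_le1 (K : numFieldType) (n : nat) (A : 'M[K]_n)
    (z : K) :
  (forall i j, 0 <= A i j) -> (forall i, \sum_j A i j = 1) ->
  eigenvalue A z -> `|z| <= 1.
Proof.
move=> A_ge0 A_sum /eigenvalueP[x xA x_neq0].
have := stochastic_l1_le A_ge0 A_sum x.
rewrite xA; under eq_bigr do rewrite mxE normrM.
rewrite -mulr_sumr ger_pMl // lt_neqAle eq_sym sumr_ge0 // andbT.
apply: contra x_neq0 => /eqP/psumr_eq0P x0.
apply/eqP/rowP => j; rewrite mxE; apply/eqP.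
by rewrite -normr_eq0 x0.
Qed.

(** * Spectral polynomials of a stochastic matrix *)

Section SpectralTheory.
Context (R : realType) (d : nat) (P : 'M[R]_d.+1) (theta : 'I_d.+1 -> R[i]).
Hypothesis theta_eig : nonunit_eigenvalues P theta.
Hypothesis P_stoch : stochastic P.
Local Notation C := R[i].
Local Notation toC := (@map_mx R C (real_complex R) _ _).
Local Notation A := (toC P).
Local Notation th k := (theta (inord k)).

Lemma eq_inord (k : nat) (i : 'I_d.+1) : (i : nat) = k -> i = inord k.
Proof. by move=> <-; apply/val_inj; rewrite /= inordK. Qed.

Lemma theta_last : th d = 1.
Proof.
by case: theta_eig => _ _ <-; congr theta; apply/esym/eq_inord.
Qed.

Lemma theta_neq1 (k : nat) : (k < d)%N -> th k != 1.
Proof.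
by case: theta_eig => H _ _ ltkd; apply: H; rewrite inordK // ltnS ltnW.
Qed.

(** The hypothesis prescribes the multiplicity of every root other than 1; that
    of the root 1 is then forced by the degree d + 1. In particular 1 is a
    simple root, so theta, with its last value 1, lists the whole spectrum.
    *)
Lemma charpoly_theta : char_poly A = \prod_(j < d.+1) ('X - (theta j)%:P).
Proof.
have [th_neq1 th_mup th_last] := theta_eig.
have [r def_r] := closed_field_poly_normal (char_poly A).
move: def_r; rewrite (monicP (char_poly_monic A)) scale1r => def_r.
have size_r : size r = d.+1.
  by apply/eqP; rewrite -eqSS -(size_prod_XsubC r id) -def_r size_char_poly.
pose t := [seq theta i | i : 'I_d.+1 <- enum 'I_d.+1 & (i < d)%N].
have perm_rt : perm_eq [seq z <- r | z != 1] t.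
  apply/allP => z; rewrite mem_cat => z_rt /=.
  have z_neq1 : z != 1.
    case/orP: z_rt; first by rewrite mem_filter => /andP[].
    by case/mapP => i; rewrite mem_filter => /andP[/th_neq1 ? _] ->.
  have -> : count_mem z [seq z <- r | z != 1] = count_mem z r.
    rewrite count_filter; apply: eq_count => y /=.
    by case: eqVneq => //= ->; rewrite z_neq1.
  rewrite -mu_prod_XsubC -def_r -th_mup // cardsE -sum1_card.
  rewrite count_map count_filter -sum1_count big_enum_cond /=.
  by apply/eqP/eq_bigl => i; rewrite andbC.
(* Of the d + 1 roots, d are listed in t and differ from 1. *)
have count_1 : count_mem 1 r = 1%N.
  have size_t : size t = d.
    rewrite size_map size_filter -sum1_count big_enum_cond /=.
    by rewrite (big_ord_narrow (leqnSn d)) sum1_card card_ord.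
  have := count_predC (pred1 1) r; rewrite size_r.
  have -> : count (predC (pred1 1)) r = d.
    by rewrite -size_t -(perm_size perm_rt) size_filter.
  by rewrite -addn1 addnC => /addnI.
rewrite def_r (bigID (fun z => z != 1)) /= -big_filter (perm_big _ perm_rt).
rewrite big_map big_filter big_enum_cond /= (big_ord_narrow (leqnSn d)) /=.
rewrite big_ord_recr /=; congr (_ * _).
under eq_bigl do rewrite negbK.
rewrite (eq_bigr (fun=> 'X - 1%:P)) => [|z /eqP->//].
by rewrite big_const_seq count_1 /= mulr1 th_last.
Qed.

Lemma spectral_polyS (k : nat) : (k <= d)%N ->
  spectral_poly P theta k.+1 = spectral_poly P theta k *m (A - (th k)%:M).
Proof. by move=> le_kd; rewrite /spectral_poly big_ord_ltS. Qed.

Lemma spectral_poly_last : spectral_poly P theta d.+1 = 0.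
Proof.
have := Cayley_Hamilton A; rewrite charpoly_theta rmorph_prod /= => <-.
apply: eq_big => [i|i _]; first exact: ltn_ord.
by rewrite rmorphB /= horner_mx_X horner_mx_C.
Qed.

(** Since P = theta_k + (P - theta_k), multiplying Q_k by P stays in place with
    weight theta_k and moves to Q_{k+1} with weight 1 - theta_k. For k = d the
    second weight is 0, and the equation holds because Q_d (P - 1) = 0. *)
Lemma Q_mulmx (k : nat) : (k <= d)%N ->
  Q P theta k *m A = th k *: Q P theta k + (1 - th k) *: Q P theta k.+1.
Proof.
move=> le_kd; rewrite addrC; apply: (canRL (subrK _)).
rewrite -mul_mx_scalar -mulmxBr.
rewrite /Q big_ord_ltS //= scalerA mulrCA mulrA -scalemxAl -spectral_polyS //.
case: (ltngtP k d) le_kd => // [lt_kd|->] _.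
  by rewrite mulfK // subr_eq0 eq_sym theta_neq1.
by rewrite spectral_poly_last !scaler0.
Qed.

Lemma Q0E : Q P theta 0 = 1%:M.
Proof. by rewrite /Q /spectral_poly !big_pred0_eq scale1r. Qed.

Lemma map_P_ge0 i j : 0 <= A i j.
Proof. by rewrite mxE lecR; case: P_stoch. Qed.

Lemma map_P_sum i : \sum_j A i j = 1.
Proof.
case: P_stoch => _ /(_ i) P1; under eq_bigr do rewrite mxE.
by rewrite -rmorph_sum P1.
Qed.

Lemma theta_norm_le1 (k : nat) : (k <= d)%N -> `|th k| <= 1.
Proof.
move=> le_kd; apply: (stochastic_eigenvalue_le1 map_P_ge0 map_P_sum).
rewrite eigenvalue_root_char charpoly_theta (bigD1 (inord k)) //=.
by rewrite rootM root_XsubC eqxx.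
Qed.

(** P - theta_k multiplies row sums by 1 - theta_k, which the normalization of
    Q_k cancels. *)
Lemma Q_row_sum (k : nat) i : (k <= d)%N -> \sum_j Q P theta k i j = 1.
Proof.
elim: k => [_|k IH lt_kd].
  rewrite Q0E (bigD1 i) //= mxE eqxx big1 ?addr0 // => j ne_ji.
  by rewrite mxE eq_sym (negbTE ne_ji).
have := stochastic_row_sum map_P_sum (Q P theta k) i.
rewrite Q_mulmx; last exact: ltnW.
under eq_bigr do rewrite lin_mxE.
rewrite big_split /= -!mulr_sumr IH ?(ltnW lt_kd) // => sumE.
have neq0 : 1 - th k != 0 by rewrite subr_eq0 eq_sym theta_neq1.
apply/(mulfI neq0)/(addrI (th k * 1)); rewrite sumE; ring.
Qed.

(** * The pure-birth chain *)

(** For k = d the successor inord d.+1 is a junk index, harmless because its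
    weight 1 - theta_d is 0. *)
Lemma Phat_rowE (k : nat) (f : 'I_d.+1 -> C) : (k <= d)%N ->
  \sum_l Phat theta (inord k) l * f l =
  th k * f (inord k) + (1 - th k) * f (inord k.+1).
Proof.
move=> le_kd; rewrite (bigD1 (inord k)) //= mxE eqxx; congr (_ + _).
case: (ltngtP k d) le_kd => // [lt_kd|->] _; last first.
  rewrite theta_last subrr mul0r big1 // => l l_neq.
  rewrite mxE (negbTE l_neq) inordK //.
  by rewrite (ltn_eqF (ltn_ord l)) mul0r.
rewrite (bigD1 (inord k.+1)) /=; last first.
  by rewrite -val_eqE /= !inordK ?ltnS ?(ltnW lt_kd) // gtn_eqF.
rewrite mxE -val_eqE /= !inordK ?ltnS // ?(ltnW lt_kd) // gtn_eqF // eqxx.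
rewrite big1 ?addr0 // => l /andP[neq_k neq_k1].
rewrite mxE (negbTE neq_k) inordK ?ltnS ?(ltnW lt_kd) //.
case: eqP => [def_l|_]; last by rewrite mul0r.
by rewrite -(eq_inord def_l) eqxx in neq_k1.
Qed.

(** The probability that the pure-birth chain with matrix Phat, started at 0,
    has reached level k by time t; a formal one unless the theta_i lie in
    [0, 1]. *)
Definition birth_cdf (k t : nat) : C :=
  \sum_(j < d.+1 | (k <= j)%N) (Phat theta ^+ t) ord0 j.

Lemma birth_cdf0 t : birth_cdf 0 t = 1.
Proof.
rewrite /birth_cdf; elim: t => [|t IH].
  rewrite expr0 (bigD1 ord0) //= mxE eqxx big1 ?addr0 // => j /negbTE nj.
  by rewrite mxE eq_sym nj.
rewrite -[RHS]IH exprSr; under eq_bigr do rewrite mxE.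
rewrite exchange_big /=; apply: eq_bigr => i _.
have := Phat_rowE (fun=> 1) (ltnSE (ltn_ord i)).
rewrite -(eq_inord (erefl (i : nat))) !mulr1 addrC subrK => row_sum.
rewrite -mulr_sumr -[RHS]mulr1 -row_sum; congr (_ * _).
by apply: eq_bigr => j _; rewrite mulr1.
Qed.

Lemma birth_cdfS0 k : birth_cdf k.+1 0 = 0.
Proof.
rewrite /birth_cdf expr0 big1 // => j lt_kj; rewrite mxE.
by case: eqP lt_kj => // <-.
Qed.

(** Level k + 1 is reached by time t + 1 if it was reached by time t, or if the
    chain sits in k at time t and jumps; the latter has weight
    (1 - theta_k) (birth_cdf k t - birth_cdf k.+1 t). *)
Lemma birth_cdfS (k t : nat) : (k <= d)%N ->
  birth_cdf k.+1 t.+1 = th k * birth_cdf k.+1 t + (1 - th k) * birth_cdf k t.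
Proof.
move=> le_kd; rewrite /birth_cdf exprSr.
set p := Phat theta ^+ t.
have -> : \sum_(j < d.+1 | (k <= j)%N) p ord0 j =
    p ord0 (inord k) + \sum_(j < d.+1 | (k < j)%N) p ord0 j.
  rewrite (bigD1 (inord k)) ?inordK //=; congr (_ + _).
  apply: eq_bigl => j; rewrite [RHS]ltn_neqAle andbC; congr (~~ _ && _).
  by rewrite -val_eqE /= inordK // eq_sym.
rewrite mulrDr addrCA -mulrDl [th k + _]addrC subrK mul1r.
under eq_bigr do rewrite mxE.
rewrite exchange_big /= [X in _ = _ + X]big_mkcond /=.
rewrite (bigD1 (inord k)) //= [in RHS](bigD1 (inord k)) //= inordK // ltnn.
have rowE i : \sum_(j < d.+1 | (k < j)%N) p ord0 i * Phat theta i j =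
    p ord0 i * (theta i * (k < i)%N%:R +
      (1 - theta i) * ((i < d) && (k <= i))%N%:R).
  rewrite -mulr_sumr; congr (_ * _).
  have := Phat_rowE (fun j => (k < j)%N%:R) (ltnSE (ltn_ord i)).
  rewrite -(eq_inord (erefl (i : nat))).
  under eq_bigr do rewrite mulr_natr mulrb.
  rewrite -big_mkcond /= => ->; congr (_ + _).
  case: (ltngtP i d) (ltnSE (ltn_ord i)) => // [lt_id|eq_id] _.
    by rewrite inordK.
  have -> : i = inord d by apply: eq_inord.
  by rewrite theta_last subrr !mul0r.
rewrite rowE inordK // ltnn leqnn mulr0 add0r andbT.
rewrite [X in _ = _ + (_ + X)](eq_bigr (fun i => p ord0 i * (k < i)%N%:R));
  last by move=> i _; rewrite mulr_natr mulrb.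
rewrite add0r [p ord0 _ * _]mulrC; congr (_ + _).
  case: (ltngtP k d) le_kd => // [lt_kd|->] _; first by rewrite mulr1.
  by rewrite theta_last subrr !mul0r.
apply: eq_bigr => i neq_ik; rewrite rowE; congr (_ * _).
have -> : (k <= i)%N = (k < i)%N.
  rewrite [RHS]ltn_neqAle andb_idl // => _.
  by apply: contra neq_ik => /eqP/esym/eq_inord->.
case: (ltngtP i d) (ltnSE (ltn_ord i)) => // [lt_id|eq_id] _.
  by rewrite /= -mulrDl addrC subrK mul1r.
have -> : i = inord d by apply: eq_inord.
by rewrite theta_last subrr mul0r mul1r addr0.
Qed.

(** * Duality between the chain and the pure-birth chain *)

(** The rows L_k = m0 Q_k enter the argument through three properties only: the
    action of P on them, the fact that the weights a are the increments of
    their last entries and, for a nonnegative spectrum, the fact that they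
    are probability vectors. *)
Section Duality.
Variables (L : nat -> 'rV[C]_d.+1) (a : nat -> C).
Hypothesis L_mulmx : forall k : nat, (k <= d)%N ->
  L k *m A = th k *: L k + (1 - th k) *: L k.+1.
Hypothesis a_sum : forall k : nat, (k <= d)%N ->
  \sum_(j < k.+1) a j = L k ord0 ord_max.

(** The rows L_k form a matrix intertwining P with Phat, hence P^t with Phat^t;
    the row of index 0 of that identity expresses the law of the chain at
    time t through the pure-birth chain at time t. *)
Lemma duality_exp (t : nat) :
  L 0 *m A ^+ t = \sum_i (Phat theta ^+ t) ord0 i *: L i.
Proof.
pose Lam : 'M[C]_d.+1 := \matrix_(i < d.+1) L i.
have intertwining : Lam *m A = Phat theta *m Lam.
  apply/row_matrixP => i; rewrite !row_mul rowK.
  have le_id : (i <= d)%N by rewrite -ltnS.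
  rewrite L_mulmx //; apply/rowP => j; rewrite lin_mxE [RHS]mxE.
  under [RHS]eq_bigr do rewrite mxE [Lam _ _]mxE.
  have := Phat_rowE (fun l => L l ord0 j) le_id.
  rewrite -(eq_inord (erefl (i : nat))) => ->; congr (_ + _).
  case: (ltngtP i d) le_id => // [lt_id|eq_id] _; first by rewrite inordK.
  by rewrite (eq_inord eq_id) theta_last subrr !mul0r.
have LamX : Lam *m A ^+ t = Phat theta ^+ t *m Lam.
  elim: t => [|t IH]; first by rewrite !expr0 mulmx1 mul1mx.
  by rewrite !exprSr mulmxA IH -mulmxA intertwining mulmxA.
have -> : L 0 = row ord0 Lam by rewrite rowK.
rewrite -row_mul LamX row_mul; apply/rowP => j.
rewrite mxE summxE; apply: eq_bigr => i _.
by rewrite [Lam _ _]mxE !mxE.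
Qed.

(** Summation by parts. *)
Lemma sum_tail_duality (x : 'I_d.+1 -> C) :
  \sum_(k < d.+1) a k * \sum_(j < d.+1 | (k <= j)%N) x j =
  \sum_j x j * L j ord0 ord_max.
Proof.
under eq_bigr => k _ do rewrite big_distrr /= big_mkcond.
rewrite exchange_big /=; apply: eq_bigr => j _.
rewrite -big_mkcond -big_distrl /= mulrC; congr (_ * _).
by rewrite (big_ord_narrow (ltn_ord j)) /= a_sum // -ltnS.
Qed.

(** * Generating function of the absorption time *)

Section GeneratingFunction.
Variable u : C.
Hypothesis u_lt1 : `|u| < 1.

(** The generating function of the time at which the pure-birth chain reaches
    level k: a product of geometric generating functions. *)
Definition birth_pgf (k : nat) : C :=
  \prod_(j < d.+1 | (j < k)%N) ((1 - theta j) * u / (1 - theta j * u)).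

(** The row m0 (1 - u P)^-1. Its coefficients on the rows L_k are those of the
    first row of (1 - u Phat)^-1. *)
Definition resolvent_row : 'rV[C]_d.+1 :=
  \sum_(k < d.+1) (birth_pgf k / (1 - th k * u)) *: L k.

Local Notation G := birth_pgf.
Local Notation x := resolvent_row.
Local Notation F n := ((L 0 *m A ^+ n) ord0 ord_max).
Local Notation f n := ((x *m A ^+ n) ord0 ord_max).

Lemma one_sub_theta_u_neq0 (k : nat) : (k <= d)%N -> 1 - th k * u != 0.
Proof.
move=> le_kd; rewrite subr_eq0; apply/negP => /eqP/(congr1 Num.norm).
rewrite normr1 normrM => e1; have := lt_geF u_lt1.
by rewrite [X in X <= _]e1 ler_piMl // theta_norm_le1.
Qed.

Lemma birth_pgfS (k : nat) : (k <= d)%N ->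
  G k.+1 = G k * ((1 - th k) * u / (1 - th k * u)).
Proof. exact: big_ord_ltS. Qed.

Lemma birth_pgf_last : G d.+1 = 0.
Proof. by rewrite birth_pgfS // theta_last subrr !mul0r mulr0. Qed.

(** The coefficients are chosen so that x - u x P telescopes from L_0 to the
    vanishing term of index d + 1. *)
Lemma resolvent_rowE : x - u *: (x *m A) = L 0.
Proof.
rewrite /resolvent_row mulmx_suml scaler_sumr -sumrB.
transitivity (\sum_(k < d.+1) (G k *: L k - G k.+1 *: L k.+1)).
  apply: eq_bigr => k _; have le_kd := ltnSE (ltn_ord k).
  rewrite -scalemxAl L_mulmx // birth_pgfS // !scalerDr !scalerA opprD addrA.
  rewrite -scalerBl; have nz := one_sub_theta_u_neq0 le_kd.
  by congr (_ *: _ - _ *: _); field.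
rewrite -(big_mkord xpredT (fun k => G k *: L k - G k.+1 *: L k.+1)).
under eq_bigr do rewrite -opprB.
rewrite sumrN telescope_sumr // birth_pgf_last scale0r sub0r opprK.
by rewrite /birth_pgf big_pred0_eq scale1r.
Qed.

(** 1 - r = (1 - u) / (1 - theta_k u) for the k-th factor r of the generating
    functions, so (1 - u) times the k-th coefficient of the resolvent row
    is the increment birth_pgf k - birth_pgf k.+1, and the tail sums of
    these increments telescope. *)
Lemma resolvent_row_absorbed : (1 - u) * f 0 = \sum_(k < d.+1) a k * G k.
Proof.
rewrite expr0 mulmx1.
have -> : \sum_(k < d.+1) a k * G k =
    \sum_(k < d.+1) a k * \sum_(j < d.+1 | (k <= j)%N) (G j - G j.+1).
  apply: eq_bigr => k _; congr (_ * _).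
  rewrite -(big_geq_mkord _ _ xpredT (fun j => G j - G j.+1)).
  under eq_bigr do rewrite -opprB.
  by rewrite sumrN telescope_sumr ?birth_pgf_last ?sub0r ?opprK // ltnW.
rewrite sum_tail_duality summxE mulr_sumr; apply: eq_bigr => k _.
have le_kd := ltnSE (ltn_ord k).
rewrite mxE mulrA; congr (_ * _); rewrite birth_pgfS //.
by have nz := one_sub_theta_u_neq0 le_kd; field.
Qed.

(** The increments of F are the probabilities of absorption at a given time. As
    F n = f n - u f n.+1, the sum of the increments weighted by powers of u
    telescopes, which gives the remainder in closed form. *)
Lemma pgf_partial_sum (N : nat) :
  \sum_(n < N.+1) u ^+ n * (F n - (if n : nat is n'.+1 then F n' else 0)) =
  \sum_(k < d.+1) a k * G k - u ^+ N.+1 * (f N.+1 - f N).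
Proof.
rewrite -resolvent_row_absorbed.
have FE n : F n = f n - u * f n.+1.
  rewrite -resolvent_rowE mulmxBl -scalemxAl -mulmxA.
  have -> : A *m A ^+ n = A ^+ n.+1 by rewrite exprS.
  by rewrite mxE [(- (_ : matrix _ _ _)) _ _]mxE
    [(_ *: (_ : matrix _ _ _)) _ _]mxE.
elim: N => [|N IH].
  by rewrite big_ord_recr big_ord0 /= FE expr0 expr1; ring.
by rewrite big_ord_recr /= IH !FE !exprS; ring.
Qed.

(** A quantitative form of the convergence of the generating series: the
    explicit rate lets the final comparison with the expectation avoid any
    interchange of limit and integral. *)
Lemma pgf_error_bound : exists2 K : R, 0 <= K & forall N : nat,
  `|\sum_(n < N.+1) u ^+ n * (F n - (if n : nat is n'.+1 then F n' else 0)) -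
    \sum_(k < d.+1) a k * G k| <= K%:C * `|u| ^+ N.+1.
Proof.
pose B : C := \sum_j `|x ord0 j|.
have f_le n : `|f n| <= B.
  have l1_le : \sum_j `|(x *m A ^+ n) ord0 j| <= B.
    elim: n => [|n IH]; first by rewrite expr0 mulmx1.
    rewrite exprSr mulmxA; apply: le_trans IH.
    exact: (stochastic_l1_le map_P_ge0 map_P_sum).
  by apply: le_trans l1_le; rewrite (bigD1 ord_max) //= lerDl sumr_ge0.
have B_ge0 : 0 <= B by apply: sumr_ge0.
exists (2 * complex.Re B).
  by rewrite mulr_ge0 //; move: B_ge0; rewrite lecE => /andP[].
move=> N; rewrite pgf_partial_sum addrAC subrr add0r normrN normrM normrX.
rewrite mulrC ler_wpM2r ?exprn_ge0 //.
have -> : (2 * complex.Re B)%:C = B + B.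
  by rewrite mulrDl !mul1r rmorphD /= RRe_real // ger0_real.
by rewrite (le_trans (ler_normB _ _)) // lerD.
Qed.

End GeneratingFunction.

(** * Nonnegative spectral polynomials *)

Section NonnegativeSpectrum.
Hypotheses (theta_ge0 : forall i, 0 <= theta i)
  (theta_le : forall i j : 'I_d.+1, (i <= j)%N -> theta i <= theta j).
Hypotheses (L_ge0 : forall (k : nat) j, (k <= d)%N -> 0 <= L k ord0 j)
  (L_sum : forall k : nat, (k <= d)%N -> \sum_j L k ord0 j = 1).

Lemma theta_lt1 (k : nat) : (k < d)%N -> th k < 1.
Proof.
move=> lt_kd; rewrite lt_neqAle theta_neq1 //= -theta_last.
by apply: theta_le; rewrite !inordK ?ltnS // ltnW.
Qed.

Hypothesis P_absorbing : absorbing P ord_max.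
Hypothesis P_accessible :
  forall i : 'I_d.+1, i != ord_max -> accessible P i ord_max.

Lemma L_last_invariant n : L d *m A ^+ n = L d.
Proof.
elim: n => [|n IH]; first by rewrite expr0 mulmx1.
by rewrite exprSr mulmxA IH L_mulmx // theta_last subrr scale0r scale1r addr0.
Qed.

Lemma absorbing_power n : (P ^+ n) ord_max ord_max = 1.
Proof.
have row_max j := absorbing_row j P_stoch P_absorbing.
elim: n => [|n IH]; first by rewrite expr0 mxE eqxx.
rewrite exprS mxE (bigD1 ord_max) //= row_max eqxx mul1r IH big1 ?addr0 //.
by move=> j j_neq; rewrite row_max (negbTE j_neq) mul0r.
Qed.

Lemma map_P_exp n i j : (A ^+ n) i j = ((P ^+ n) i j)%:C.
Proof. by rewrite -rmorphXn /= mxE. Qed.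

(** The row L_d is an invariant probability vector. Invariance under a power of
    P that leads from i to the absorbing state with positive probability
    forces the mass at i to be 0, so L_d is concentrated at the absorbing
    state. *)
Lemma L_last_ord_max : L d ord0 ord_max = 1.
Proof.
have L_other i : i != ord_max -> L d ord0 i = 0.
  move=> /[dup] i_neq /P_accessible[n Pn_gt0].
  have /matrixP/(_ ord0 ord_max) := L_last_invariant n.
  rewrite [LHS]mxE (bigD1 ord_max) //= map_P_exp absorbing_power mulr1.
  move/(canRL (addKr _)); rewrite addNr => /psumr_eq0P H.
  have /eqP : L d ord0 i * (A ^+ n) i ord_max = 0.
    apply: H => // j _; rewrite mulr_ge0 ?L_ge0 // map_P_exp lecR.
    elim: n {Pn_gt0} j ord_max => [|n IH] j l.
      by rewrite expr0 mxE; case: eqP.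
    by rewrite exprS mxE sumr_ge0 // => r _; rewrite mulr_ge0 //; case: P_stoch.
  by rewrite mulf_eq0 map_P_exp fmorph_eq0 (gt_eqF Pn_gt0) orbF => /eqP.
by rewrite -(L_sum (leqnn d)) (bigD1 ord_max) //= big1 ?addr0.
Qed.

(** One step of P cannot decrease the mass of the absorbing state, and L_k P is
    the convex combination theta_k L_k + (1 - theta_k) L_{k+1}. *)
Lemma L_ord_max_le (k : nat) : (k < d)%N ->
  L k ord0 ord_max <= L k.+1 ord0 ord_max.
Proof.
move=> lt_kd; have le_kd := ltnW lt_kd.
have th_lt1 := theta_lt1 lt_kd.
have : L k ord0 ord_max <= (L k *m A) ord0 ord_max.
  rewrite [leRHS]mxE (bigD1 ord_max) //= [A _ _]mxE P_absorbing mulr1.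
  by rewrite lerDl sumr_ge0 // => i _; rewrite mulr_ge0 ?L_ge0 ?map_P_ge0.
rewrite L_mulmx // 3!mxE -subr_ge0 => le.
rewrite -(ler_pM2l (_ : 0 < 1 - th k)) ?subr_gt0 // -subr_ge0.
by apply: le_trans le _; rewrite le_eqVlt; apply/orP; left; apply/eqP; ring.
Qed.

Lemma mixture_weight_ge0 (k : nat) : (k <= d)%N -> 0 <= a k.
Proof.
case: k => [|k] le_kd; have := a_sum le_kd; rewrite big_ord_recr /=.
  by rewrite big_ord0 add0r => ->; rewrite L_ge0.
rewrite a_sum ?(ltnW le_kd) // => /(canRL (addKr _))->.
by rewrite addrC subr_ge0 L_ord_max_le.
Qed.

Lemma mixture_weight_sum : \sum_(k < d.+1) a k = 1.
Proof. by rewrite a_sum // L_last_ord_max. Qed.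

Lemma birth_cdf_bounds (k t : nat) : (k <= d)%N -> 0 <= birth_cdf k t <= 1.
Proof.
elim: k t => [|k IHk] t le_kd; first by rewrite birth_cdf0 ler01 lexx.
have th_ge0 := theta_ge0 (inord k); have th_lt1 := theta_lt1 le_kd.
elim: t => [|t /andP[H0 H1]]; first by rewrite birth_cdfS0 lexx ler01.
have le_kd' := ltnW le_kd; have /andP[I0 I1] := IHk t le_kd'.
have th'_ge0 : 0 <= 1 - th k by rewrite subr_ge0 ltW.
rewrite birth_cdfS // addr_ge0 ?mulr_ge0 //=.
rewrite -[X in _ <= X](subrK (th k) 1) addrC lerD //.
  by rewrite -[leRHS]mulr1 ler_wpM2l.
by rewrite -[leRHS]mulr1 ler_wpM2l.
Qed.

(** The expected time to reach level k is finite. In the induction, the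
    expected time spent in level k before time N is at most 1 / (1 -
    theta_k), since (1 - theta_k) times it is the probability of having
    left that level by time N. *)
Lemma birth_survival_sum_bound (k N : nat) : (k <= d)%N ->
  \sum_(t < N) (1 - birth_cdf k t) <= \sum_(j < k) (1 - th j)^-1.
Proof.
elim: k => [|k IH] le_kd.
  by rewrite !big_ord0 big1 // => t _; rewrite birth_cdf0 subrr.
have le_kd' := ltnW le_kd.
have th_gt0 : 0 < 1 - th k by rewrite subr_gt0 theta_lt1.
rewrite big_ord_recr /=.
have -> : \sum_(t < N) (1 - birth_cdf k.+1 t) =
    \sum_(t < N) (1 - birth_cdf k t) +
    \sum_(t < N) (birth_cdf k t - birth_cdf k.+1 t).
  by rewrite -big_split /=; apply: eq_bigr => t _; ring.
rewrite lerD ?IH // -(ler_pM2l th_gt0) mulfV ?gt_eqF // mulr_sumr.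
rewrite (eq_bigr (fun t : 'I_N => birth_cdf k.+1 t.+1 - birth_cdf k.+1 t));
  last by move=> t _; rewrite birth_cdfS //; ring.
rewrite -(big_mkord xpredT (fun t => birth_cdf k.+1 t.+1 - birth_cdf k.+1 t)).
rewrite telescope_sumr // birth_cdfS0 subr0.
by case/andP: (birth_cdf_bounds N le_kd).
Qed.

End NonnegativeSpectrum.

End Duality.

(** * The rows of Lambda *)

Section SpectralRows.
Variable m0 : 'rV[R]_d.+1.
Local Notation L k := (toC m0 *m Q P theta k).

Lemma spectral_row_mulmx (k : nat) : (k <= d)%N ->
  L k *m A = th k *: L k + (1 - th k) *: L k.+1.
Proof. by move=> le_kd; rewrite -mulmxA Q_mulmx // mulmxDr -!scalemxAr. Qed.

Lemma spectral_row0 : L 0 = toC m0.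
Proof. by rewrite Q0E mulmx1. Qed.

Lemma a_coef_partial_sum (k : nat) : (k <= d)%N ->
  \sum_(j < k.+1) a_coef m0 P theta j = L k ord0 ord_max.
Proof.
move=> le_kd; rewrite -(big_mkord xpredT (fun j => a_coef m0 P theta j)).
by rewrite telescope_sumr //= subr0 le_kd mxE inordK.
Qed.

Hypotheses (m0_ge0 : forall i, 0 <= m0 ord0 i) (m0_sum : \sum_i m0 ord0 i = 1).

Lemma spectral_row_sum (k : nat) : (k <= d)%N -> \sum_j L k ord0 j = 1.
Proof.
move=> le_kd; under eq_bigr do rewrite mxE.
rewrite exchange_big /=.
under eq_bigr do rewrite -mulr_sumr Q_row_sum // mulr1 mxE.
by rewrite -rmorph_sum m0_sum.
Qed.

Hypothesis theta_le : forall i j : 'I_d.+1, (i <= j)%N -> theta i <= theta j.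

Lemma spectral_row_ge0 (k : nat) j : (k <= d)%N ->
  mx_nonneg (spectral_poly P theta k) -> 0 <= L k ord0 j.
Proof.
move=> le_kd S_ge0; rewrite mxE sumr_ge0 // => i _.
rewrite mulr_ge0 //; first by rewrite mxE ler0c.
rewrite mxE mulr_ge0 // prodr_ge0 // => l lt_lk; rewrite invr_ge0 subr_ge0.
rewrite [l](eq_inord (erefl (l : nat))) ltW // theta_lt1 //.
exact: leq_trans le_kd.
Qed.

End SpectralRows.

End SpectralTheory.

(** * Convolutions of geometric distributions *)

Section Convolution.
Context (R : realType).
Implicit Types f g h : nat -> R.

(** Convolutions are coefficients of products of truncated generating
    polynomials; the algebra of convolution is inherited from that of
    polynomials. *)
Lemma conv_pmf_coef (N n : nat) f g : (n < N)%N ->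
  conv_pmf f g n = (\poly_(i < N) f i * \poly_(i < N) g i)`_n.
Proof.
move=> lt_nN; rewrite coefM; apply: eq_bigr => i _.
have le_in : (i <= n)%N by rewrite -ltnS.
by rewrite !coef_poly (leq_ltn_trans le_in) // (leq_ltn_trans (leq_subr _ _)).
Qed.

Lemma poly_conv_pmf_coef (N n : nat) f g : (n < N)%N ->
  (\poly_(i < N) conv_pmf f g i)`_n =
  (\poly_(i < N) f i * \poly_(i < N) g i)`_n.
Proof. by move=> lt_nN; rewrite coef_poly lt_nN (conv_pmf_coef _ _ lt_nN). Qed.

(** The factors of an iterated convolution are nested to the right;
    associativity is what lets the last one, the geometric law of theta_k,
    be split off. *)
Lemma conv_pmfA : associative (@conv_pmf R).
Proof.
move=> f g h; apply/funext => n; have lt_nn := ltnSn n.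
rewrite !(conv_pmf_coef _ _ lt_nn).
transitivity ((\poly_(i < n.+1) f i *
    (\poly_(i < n.+1) g i * \poly_(i < n.+1) h i))`_n).
  rewrite !coefM; apply: eq_bigr => i _.
  by rewrite poly_conv_pmf_coef // ltnS leq_subr.
rewrite mulrA [LHS]coefM [RHS]coefM; apply: eq_bigr => i _.
by rewrite poly_conv_pmf_coef.
Qed.

Lemma conv_dirac0 : left_id (@dirac0_pmf R) (@conv_pmf R).
Proof.
move=> f; apply/funext => n; rewrite /conv_pmf big_ord_recl /= subn0 mul1r.
by rewrite big1 ?addr0 // => i _; rewrite mul0r.
Qed.

Lemma conv_pmfC : commutative (@conv_pmf R).
Proof.
move=> f g; apply/funext => n; have lt_nn := ltnSn n.
by rewrite !(conv_pmf_coef _ _ lt_nn) mulrC.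
Qed.

Lemma conv_pmf_dirac0 : right_id (@dirac0_pmf R) (@conv_pmf R).
Proof. by move=> f; rewrite conv_pmfC conv_dirac0. Qed.

HB.instance Definition _ := Monoid.isLaw.Build (nat -> R) (@dirac0_pmf R)
  (@conv_pmf R) conv_pmfA conv_dirac0 conv_pmf_dirac0.

Lemma conv_geometric0 f (p : R) : conv_pmf f (geometric_pmf p) 0 = 0.
Proof. by rewrite /conv_pmf big_ord_recr big_ord0 /= mulr0 add0r. Qed.

Lemma conv_geometricS f (p : R) (n : nat) :
  conv_pmf f (geometric_pmf p) n.+1 =
  (1 - p) * conv_pmf f (geometric_pmf p) n + p * f n.
Proof.
rewrite /conv_pmf big_ord_recr /= subnn mulr0 addr0.
rewrite big_ord_recr /= subSnn /= expr0 mulr1 [f n * p]mulrC; congr (_ + _).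
rewrite [in RHS]big_ord_recr /= subnn mulr0 addr0 mulr_sumr.
apply: eq_bigr => i _; rewrite subSn; last exact: ltnW.
have : (0 < n - i)%N by rewrite subn_gt0.
by case: (n - i)%N => // m _ /=; rewrite exprS; ring.
Qed.

(** With p = 1 - theta_k this is the recursion satisfied by birth_cdf: hence
    the birth times are sums of independent geometric times. *)
Lemma conv_geometric_cdfS f (p : R) (t : nat) :
  \sum_(n < t.+2) conv_pmf f (geometric_pmf p) n =
  (1 - p) * (\sum_(n < t.+1) conv_pmf f (geometric_pmf p) n) +
  p * \sum_(n < t.+1) f n.
Proof.
rewrite big_ord_recl conv_geometric0 add0r !mulr_sumr -big_split /=.
by apply: eq_bigr => n _; rewrite -conv_geometricS.
Qed.

Lemma birth_cdf_conv_geometric (d : nat) (P : 'M[R]_d.+1)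
    (theta : 'I_d.+1 -> R[i]) (k t : nat) :
  nonunit_eigenvalues P theta -> (forall i, theta i \is Num.real) ->
  (k <= d)%N ->
  (\sum_(n < t.+1) conv_geometric_pmf theta k n)%:C = birth_cdf theta k t.
Proof.
move=> theta_eig theta_real.
elim: k t => [|k IH] t le_kd.
  rewrite (birth_cdf0 theta_eig) /conv_geometric_pmf big_pred0_eq.
  by rewrite big_ord_recl big1 ?addr0.
have le_kd' := ltnW le_kd.
have pmfS : conv_geometric_pmf theta k.+1 = conv_pmf (conv_geometric_pmf theta k)
    (geometric_pmf (1 - complex.Re (theta (inord k)))).
  exact: big_ord_ltS.
elim: t => [|t IHt].
  by rewrite big_ord1 pmfS conv_geometric0 birth_cdfS0.
set r := complex.Re (theta (inord k)) in pmfS.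
have theta_r : theta (inord k) = r%:C by rewrite RRe_real.
rewrite (birth_cdfS theta_eig) // -IHt -IH // pmfS conv_geometric_cdfS -pmfS.
by rewrite theta_r rmorphD !rmorphM !rmorphB !rmorph1 /=; ring.
Qed.

End Convolution.

(** * Events and times with values in a countable set *)

Section Fibres.
Context (R : realType) (dsp : measure_display) (Omega : measurableType dsp)
  (Pr : probability Omega R).

Lemma prob_fin_num (E : set Omega) : measurable E -> Pr E \is a fin_num.
Proof. exact: fin_num_measure. Qed.

Lemma prob_fibre_sum (I : finType) (Y : Omega -> I) (E : set Omega) :
  measurable E -> (forall i, measurable [set w | Y w = i]) ->
  fine (Pr E) = \sum_i fine (Pr (E `&` [set w | Y w = i])).
Proof.
move=> mE mY.
have mEY i : measurable (E `&` [set w | Y w = i]) by exact: measurableI.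
have {1}-> : E = \bigcup_(i in [set: I]) (E `&` [set w | Y w = i]).
  apply/seteqP; split=> [w Ew|w [i _ []]//].
  by exists (Y w).
have finI : finite_set [set: I] by exact: finite_finset.
rewrite measure_fin_bigcup //; last by move=> i j _ _ [w [[_ <-] [_ <-]]].
rewrite (fsbigE (index_enum I)) ?index_enum_uniq //; last 1 first.
  by move=> i _; rewrite mem_index_enum.
rewrite big_mkcond /=.
rewrite -sum_fine => [|i _]; last by case: ifP => // _; exact: prob_fin_num.
by apply: eq_bigr => i _; rewrite in_setT.
Qed.

Lemma prob_null_subset (E F : set Omega) : measurable E -> measurable F ->
  E `<=` F -> fine (Pr F) = 0 -> fine (Pr E) = 0.
Proof.
move=> mE mF EF F0; apply/eqP; rewrite eq_le; apply/andP; split; last first.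
  exact: fine_ge0.
by rewrite -F0 fine_le ?prob_fin_num // le_measure // inE.
Qed.

End Fibres.

Section DiscreteTime.
Context (R : realType) (dsp : measure_display) (Omega : measurableType dsp)
  (Pr : probability Omega R) (T : Omega -> option nat).
Hypothesis mT : forall n, measurable [set w | T w = Some n].
Local Notation p n := (fine (Pr [set w | T w = Some (n : nat)])).

(** The fibre of None is the complement of a countable union of measurable
    fibres, and any other event is a countable union of fibres. *)
Lemma measurable_fibre (Y : option nat -> Prop) :
  measurable [set w | Y (T w)].
Proof.
have mNone : measurable [set w | T w = None].
  rewrite (_ : [set w | _] = ~` (\bigcup_n [set w | T w = Some n])).
    by apply: measurableC; apply: bigcup_measurable.
  apply/seteqP; split=> w /=; first by move=> TN [n _]; rewrite /= TN.
  by case Tw: (T w) => [n|] // []; exists n.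
rewrite (_ : [set w | _] =
    ([set w | T w = None] `&` [set w | Y None]) `|`
    \bigcup_(n in [set n | Y (Some n)]) [set w | T w = Some n]).
  apply: measurableU; last exact: bigcup_measurable.
  have [YN|YN] := pselect (Y None).
    by rewrite [X in _ `&` X](_ : _ = setT) ?setIT //; apply/seteqP; split.
  by rewrite [X in _ `&` X](_ : _ = set0) ?setI0 // -subset0.
apply/seteqP; split=> w /=.
  by case Tw: (T w) => [n|] Yw; [right; exists n|left].
by case=> [[-> //]|[n Yn ->]].
Qed.

Lemma measurable_time_le t : measurable [set w | time_le (T w) t].
Proof. exact: (measurable_fibre (fun s => time_le s t)). Qed.

Lemma cdf_pmf t : fine (Pr [set w | time_le (T w) t]) = \sum_(n < t.+1) p n.
Proof.
elim: t => [|t IH].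
  rewrite big_ord_recr big_ord0 /= add0r; congr (fine (Pr _)).
  apply/seteqP; split=> w /=; last by move=> ->.
  by case: (T w) => // n; rewrite /= leqn0 => /eqP->.
rewrite big_ord_recr /= -IH -fineD ?prob_fin_num //; last first.
  exact: measurable_time_le.
rewrite -measureU //; last 2 first.
- exact: measurable_time_le.
- by rewrite -subset0 => w [] /= + Tw; rewrite Tw /= ltnn.
congr (fine (Pr _)); apply/seteqP; split=> w /=.
  case: (T w) => //= n; rewrite leq_eqVlt => /orP[/eqP->|]; first by right.
  by left.
by case=> [|-> /=]; last exact: leqnn; case: (T w) => //= n /leqW.
Qed.

Lemma integrable_bounded_time (g : option nat -> R) (M : R) :
  (forall s, `|g s| <= M) ->
  Pr.-integrable setT (EFin \o (fun w => g (T w))).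
Proof.
move=> g_le; apply: measurable_bounded_integrable => //.
- exact: le_lt_trans (probability_le1 Pr measurableT) (ltry 1).
- by move=> _ Y mY; rewrite setTI; exact: (measurable_fibre (fun s => Y (g s))).
- exists M; split; first exact: num_real.
  by move=> y lt_My w _ /=; exact: le_trans (g_le _) (ltW lt_My).
Qed.

(** Removing the values of g at finitely many times, one at a time, leaves a
    function bounded by eps. *)
Lemma expectation_time_approx (N : nat) (g : option nat -> R) (M eps : R) :
  (forall s, `|g s| <= M) ->
  (forall s, (forall n, (n < N)%N -> s <> Some n) -> `|g s| <= eps) ->
  `|fine ('E_Pr[fun w => g (T w)])%E - \sum_(n < N) g (Some (n : nat)) * p n|
    <= eps.
Proof.
rewrite unlock -/(Rintegral Pr setT (fun w => g (T w))) => g_le.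
elim: N g g_le => [|N IH] g g_le g_eps.
  have g_le_eps s : `|g s| <= eps by exact: g_eps.
  rewrite big_ord0 subr0; have int_g := integrable_bounded_time g_le.
  apply: le_trans (le_normr_Rintegral measurableT int_g) _.
  have -> : eps = Rintegral Pr setT (fun=> eps).
    rewrite Rintegral_cst // -[LHS]mulr1; congr (_ * _).
    exact/esym/(congr1 fine (probability_setT Pr)).
  apply: le_Rintegral => //.
  - by apply: (@integrable_bounded_time (fun s => `|g s|) M) => s; rewrite normr_id.
  - by apply: (@integrable_bounded_time (fun s => eps) `|eps|).
pose g' s := if s == Some N then 0 else g s.
have M_ge0 : 0 <= M by apply: le_trans (g_le None).
have g'_le s : `|g' s| <= M by rewrite /g'; case: ifP; rewrite ?normr0.
have eps_ge0 : 0 <= eps by apply: le_trans (g_eps None _).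
have g'_eps s : (forall n, (n < N)%N -> s <> Some n) -> `|g' s| <= eps.
  move=> sN; rewrite /g'; case: eqP => [_|neq]; first by rewrite normr0.
  apply: g_eps => n; rewrite ltnS leq_eqVlt => /orP[/eqP->//|].
  exact: sN.
have := IH g' g'_le g'_eps.
have -> : \sum_(n < N) g' (Some (n : nat)) * p n =
    \sum_(n < N) g (Some (n : nat)) * p n.
  apply: eq_bigr => n _; rewrite /g' ifF //.
  by apply/negP => /eqP[nN]; have := ltn_ord n; rewrite nN ltnn.
have -> : \int[Pr]_w g (T w) = \int[Pr]_w g' (T w) + g (Some N) * p N.
  have -> : p N = \int[Pr]_w \1_[set w | T w = Some N] w.
    by rewrite /Rintegral integral_indic // setIT.
  rewrite -RintegralZl //; last exact: integrable_indic.
  rewrite -RintegralD //; first last.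
  - rewrite (_ : _ \o _ =
        (fun w => (g (Some N))%:E * (\1_[set w | T w = Some N] w)%:E)%E) //.
    by apply: integrableZl => //; exact: integrable_indic.
  - exact: integrable_bounded_time g'_le.
  apply: eq_Rintegral => w _; rewrite /g' indicE.
  case: eqP => [Tw|Tw]; first by rewrite Tw mem_set // mulr1 add0r.
  by rewrite memNset // mulr0 addr0.
by rewrite big_ord_recr /= opprD addrACA subrr addr0.
Qed.

End DiscreteTime.

(** * Law of a Markov chain and of its absorption time *)

Section ChainDistribution.
Context (R : realType) (d : nat) (dsp : measure_display)
  (Omega : measurableType dsp) (Pr : probability Omega R).
Variables (X : nat -> Omega -> 'I_d.+1) (m0 : 'rV[R]_d.+1) (P : 'M[R]_d.+1).
Hypothesis X_chain : markov_chain Pr X m0 P.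

Let mX n i : measurable [set w | X n w = i].
Proof. by case: X_chain. Qed.

Lemma initial_ge0 i : 0 <= m0 ord0 i.
Proof. by case: X_chain => _ _ /(_ i) init _; rewrite -lee_fin -init. Qed.

Lemma initial_sum : \sum_i m0 ord0 i = 1.
Proof.
have [_ _ init _] := X_chain.
have := prob_fibre_sum Pr measurableT (mX 0); rewrite probability_setT /= => ->.
by apply: eq_bigr => i _; rewrite setTI init.
Qed.

Lemma measurable_history n (h : nat -> 'I_d.+1) :
  measurable [set w | forall k, (k <= n)%N -> X k w = h k].
Proof.
rewrite (_ : [set w | _] =
    \bigcap_(k in [set k | (k <= n)%N]) [set w | X k w = h k]) //.
exact: bigcap_measurableType.
Qed.

Lemma history_step n (h : nat -> 'I_d.+1) j :
  let history := [set w | forall k, (k <= n)%N -> X k w = h k] in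
  fine (Pr (history `&` [set w | X n.+1 w = j])) =
  fine (Pr history) * P (h n) j.
Proof.
move=> history; have m_hist : measurable history by exact: measurable_history.
(* The Markov property says nothing about a null history; both sides are 0. *)
have [hist0|/eqP hist_neq0] := eqVneq (fine (Pr history)) 0.
  rewrite hist0 mul0r; apply: prob_null_subset hist0 => //.
  exact: measurableI.
have [_ _ _ /(_ n h j) markov] := X_chain.
rewrite -markov; last first.
  rewrite lt0e measure_ge0 andbT; apply: contra_notN hist_neq0 => /eqP.
  by rewrite -/history => ->.
by rewrite /cond_prob setIC mulrC divfK //; apply/eqP.
Qed.

(** The Markov property is only given conditionally on the full history, so the
    event {X_n = i} is cut into the histories ending at i. *)
Lemma transition_prob n i j :
  fine (Pr ([set w | X n w = i] `&` [set w | X n.+1 w = j])) =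
  fine (Pr [set w | X n w = i]) * P i j.
Proof.
pose Y w : {ffun 'I_n.+1 -> 'I_d.+1} := [ffun k : 'I_n.+1 => X k w].
pose ext (h : {ffun 'I_n.+1 -> 'I_d.+1}) (k : nat) := h (inord k).
have YE h : [set w | Y w = h] =
    [set w | forall k, (k <= n)%N -> X k w = ext h k].
  apply/seteqP; split=> [w /= <- k le_kn|w /= Xh].
    by rewrite /ext ffunE inordK.
  apply/ffunP => k; rewrite ffunE Xh /ext; last by rewrite -ltnS.
  by congr (h _); apply/val_inj; rewrite /= inordK.
have mY h : measurable [set w | Y w = h].
  by rewrite YE; exact: measurable_history.
rewrite (prob_fibre_sum Pr _ mY); last exact: measurableI.
rewrite (prob_fibre_sum Pr (mX n i) mY) mulr_suml; apply: eq_bigr => h _.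
have [hi|/eqP hi] := eqVneq (ext h n) i.
  have sub : [set w | Y w = h] `<=` [set w | X n w = i].
    by rewrite YE -hi => w /= ->.
  rewrite setIAC [[set w | X n w = i] `&` _]setIidr // YE history_step.
  by rewrite hi.
rewrite setIAC.
have -> : [set w | X n w = i] `&` [set w | Y w = h] = set0.
  by rewrite YE -subset0 => w /= [Xi Xh]; apply: hi; rewrite -Xh.
by rewrite set0I measure0 mul0r.
Qed.

Lemma state_prob n j :
  fine (Pr [set w | X n w = j]) = (m0 *m P ^+ n) ord0 j.
Proof.
elim: n j => [|n IH] j.
  by rewrite expr0 mulmx1; case: X_chain => _ _ -> _.
rewrite exprSr mulmxA mxE (prob_fibre_sum Pr (mX n.+1 j) (mX n)).
by apply: eq_bigr => i _; rewrite setIC transition_prob IH.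
Qed.

Section Absorption.
Variable e : 'I_d.+1.
Hypothesis e_absorbing : absorbing P e.

Lemma leave_absorbing_prob n j : j != e ->
  fine (Pr ([set w | X n w = e] `&` [set w | X n.+1 w = j])) = 0.
Proof.
have [P_stoch _ _ _] := X_chain => /negbTE j_neq.
by rewrite transition_prob (absorbing_row _ P_stoch e_absorbing) j_neq mulr0.
Qed.

Lemma time_le_hitting w t :
  time_le (hitting_time X e w) t <-> exists2 n, (n <= t)%N & X n w = e.
Proof.
rewrite /hitting_time; case: pselect => [hits|no_hit] /=; last first.
  split=> // -[n _ Xn]; apply: no_hit.
  by exists n; apply/eqP.
case: ex_minnP => n /eqP Xn n_min; split=> [le_nt|[m le_mt /eqP Xm]].
  by exists n.
exact: leq_trans (n_min _ Xm) le_mt.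
Qed.

Lemma hitting_time_Some w n :
  hitting_time X e w = Some n <->
  X n w = e /\ forall m, (m < n)%N -> X m w <> e.
Proof.
rewrite /hitting_time; case: pselect => [hits|no_hit] /=; last first.
  by split=> // -[Xn _]; case: no_hit; exists n; apply/eqP.
case: ex_minnP => k /eqP Xk k_min; split=> [[<-]|[Xn n_min]].
  by split=> // m lt_mk /eqP/k_min; rewrite leqNgt lt_mk.
congr Some; apply/eqP; rewrite eqn_leq k_min /=; last exact/eqP.
by rewrite leqNgt; apply/negP => /n_min.
Qed.

Lemma measurable_hitting_time n :
  measurable [set w | hitting_time X e w = Some n].
Proof.
rewrite (_ : [set w | _] = [set w | X n w = e] `&`
    \bigcap_(m in [set m | (m < n)%N]) ~` [set w | X m w = e]).
  apply: measurableI => //; apply: bigcap_measurableType => // m _.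
  exact: measurableC.
by apply/seteqP; split=> w /=; move/hitting_time_Some.
Qed.

(** The chain almost surely makes no one-step transition out of e, so once it
    has hit e it is there at time t, up to a null event. This reduces the
    law of the hitting time to the one-dimensional marginals of the chain.
    *)
Lemma absorbed_elsewhere_prob t j : j != e ->
  fine (Pr ([set w | time_le (hitting_time X e w) t] `&`
            [set w | X t w = j])) = 0.
Proof.
elim: t j => [|t IH] j j_neq.
  rewrite (_ : _ `&` _ = set0) ?measure0 // -subset0 => w /= [].
  move/time_le_hitting => [n]; rewrite leqn0 => /eqP -> -> je.
  by rewrite je eqxx in j_neq.
have mT := measurable_time_le measurable_hitting_time.
have mTj := measurableI _ _ (mT t.+1) (mX t.+1 j).
rewrite (prob_fibre_sum Pr mTj (mX t)) big1 // => i _.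
have mTji := measurableI _ _ mTj (mX t i).
have [->|i_neq] := eqVneq i e.
  apply: prob_null_subset (leave_absorbing_prob t j_neq) => //.
  - by apply: measurableI.
  - by apply: measurableI.
  - by move=> w [[_ ? ?]].
apply: prob_null_subset (IH i i_neq) => //.
- exact: measurableI.
- move=> w /= [[/time_le_hitting[n le_nt Xn] Xj] Xi]; split=> //.
  apply/time_le_hitting; exists n => //; move: le_nt; rewrite leq_eqVlt.
  case/orP=> [/eqP n_eq|//]; move: Xn; rewrite n_eq Xj => je.
  by rewrite je eqxx in j_neq.
Qed.

Lemma absorption_cdf t :
  fine (Pr [set w | time_le (hitting_time X e w) t]) =
  (m0 *m P ^+ t) ord0 e.
Proof.
have mT := measurable_time_le measurable_hitting_time.
rewrite -state_prob (prob_fibre_sum Pr (mT t) (mX t)).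
rewrite (bigD1 e) //= big1 ?addr0 => [|j j_neq]; last first.
  exact: absorbed_elsewhere_prob.
congr (fine (Pr _)); apply/setIidPr => w /= Xt.
by apply/time_le_hitting; exists t.
Qed.

End Absorption.

End ChainDistribution.

(** * Complex expectations, and two null bounds *)

Section ComplexParts.
Context (R : realType).
Local Notation C := R[i].

Lemma Re_wsum (N : nat) (z : nat -> C) (p : nat -> R) :
  complex.Re (\sum_(n < N) z n * (p n)%:C) = \sum_(n < N) complex.Re (z n) * p n.
Proof.
rewrite (big_morph (@complex.Re R) (id1 := 0) (op1 := +%R)) //; last first.
  by move=> [x y] [x' y'].
by apply: eq_bigr => n _; case: (z n) => x y /=; rewrite mulr0 subr0.
Qed.

Lemma Im_wsum (N : nat) (z : nat -> C) (p : nat -> R) :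
  complex.Im (\sum_(n < N) z n * (p n)%:C) = \sum_(n < N) complex.Im (z n) * p n.
Proof.
rewrite (big_morph (@complex.Im R) (id1 := 0) (op1 := +%R)) //; last first.
  by move=> [x y] [x' y'].
by apply: eq_bigr => n _; case: (z n) => x y /=; rewrite mulr0 add0r.
Qed.

Lemma norm_i : `|'i%C : C| = 1.
Proof. by rewrite normc_def /= expr0n expr1n add0r sqrtr1. Qed.

Lemma normc_ge_Im (z : C) : `|complex.Im z|%:C <= `|z|.
Proof.
have := normc_ge_Re (z * 'i%C).
by rewrite ReiNIm normrN normrM norm_i mulr1.
Qed.

Lemma normc_le_Re_Im (z : C) :
  `|z| <= (`|complex.Re z| + `|complex.Im z|)%:C.
Proof.
rewrite {1}[z]complexE rmorphD /= (le_trans (ler_normD _ _)) //.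
rewrite normrM norm_i mul1r.
by rewrite lerD // normc_def /= expr0n addr0 sqrtr_sqr.
Qed.

Lemma norm_complexE (z : C) : `|z| = (complex.Re `|z|)%:C.
Proof. by rewrite RRe_real. Qed.

End ComplexParts.

Section GeneratingFunctionApprox.
Context (R : realType) (dsp : measure_display) (Omega : measurableType dsp)
  (Pr : probability Omega R) (T : Omega -> option nat).
Hypothesis mT : forall n, measurable [set w | T w = Some n].
Local Notation p n := (fine (Pr [set w | T w = Some (n : nat)])).

(** Each of the real and imaginary parts of u^T contributes an error of at most
    |u|^N, as u^T is at most |u|^N outside {T < N}, including on {T = oo}. *)
Lemma cexpectation_pow_approx (N : nat) (u : R[i]) : `|u| < 1 ->
  `|cexpectation Pr (fun w => time_pow u (T w)) -
    \sum_(n < N) u ^+ n * (p n)%:C| <= 2 * `|u| ^+ N.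
Proof.
move=> u_lt1; set r := complex.Re `|u|.
have ur : `|u| = r%:C by exact: norm_complexE.
have r_ge0 : 0 <= r by rewrite -ler0c -ur.
have r_le1 : r <= 1 by rewrite -lecR -ur; exact: ltW u_lt1.
have pow_le1 s : `|time_pow u s| <= 1%:C.
  case: s => [n|] /=; last by rewrite normr0 ler0c.
  by rewrite normrX; apply: exprn_ile1 => //; exact: ltW u_lt1.
have pow_leN s : (forall n, (n < N)%N -> s <> Some n) ->
    `|time_pow u s| <= (r ^+ N)%:C.
  case: s => [n|] sN /=; last by rewrite normr0 ler0c exprn_ge0.
  rewrite normrX ur -rmorphXn lecR /=; apply: ler_wiXn2l => //.
  by rewrite leqNgt; apply/negP => /sN.
have le_of (f : R[i] -> R) (f_le : forall z, `|f z|%:C <= `|z|) z b :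
    `|z| <= b%:C -> `|f z| <= b.
  by rewrite -lecR; exact: le_trans.
have approx (f : R[i] -> R) (f_le : forall z, `|f z|%:C <= `|z|) :
    `|fine ('E_Pr[fun w => f (time_pow u (T w))])%E -
      \sum_(n < N) f (u ^+ n) * p n| <= r ^+ N.
  apply: (expectation_time_approx Pr mT (N := N) (g := fun s => f (time_pow u s))
    (M := 1)) => [s|s sN].
    exact: le_of (pow_le1 s).
  exact: le_of (pow_leN s sN).
apply: le_trans (normc_le_Re_Im _) _.
have -> : 2 * `|u| ^+ N = (r ^+ N + r ^+ N)%:C.
  by rewrite ur rmorphD rmorphXn /= mulrDl !mul1r.
rewrite lecR; apply: lerD.
- have := approx _ (@normc_ge_Re R).
  have /= <- := Re_wsum N (fun n => u ^+ n) (fun n => p n).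
  by case: (\sum_(n < N) _).
- have := approx _ (@normc_ge_Im R).
  have /= <- := Im_wsum N (fun n => u ^+ n) (fun n => p n).
  by case: (\sum_(n < N) _).
Qed.

End GeneratingFunctionApprox.

Lemma geometric_bound_eq0 (R : realType) (c K r : R) : 0 <= c -> 0 <= r < 1 ->
  (forall N, c <= K * r ^+ N) -> c = 0.
Proof.
move=> c_ge0 /andP[r_ge0 r_lt1] c_le; apply/eqP; rewrite eq_le c_ge0 andbT.
have lim0 : K * r ^+ N @[N --> \oo] --> K * 0.
  by apply: cvgM; [exact: cvg_cst|apply: cvg_expr; rewrite ger0_norm].
rewrite -(mulr0 K) -(cvg_lim _ lim0) //; apply: limr_ge.
  by apply/cvg_ex; exists (K * 0).
by near=> N.
Unshelve. all: by end_near. Qed.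

Lemma linear_bound_eq0 (R : realType) (q B : R) : 0 <= q ->
  (forall N : nat, q * N%:R <= B) -> q = 0.
Proof.
move=> q_ge0 q_le; apply/eqP; rewrite eq_le q_ge0 andbT leNgt; apply/negP => q_gt0.
have B_ge0 : 0 <= B / q by rewrite divr_ge0 // (le_trans _ (q_le 0%N)) // mulr0.
have := archi_boundP B_ge0; rewrite ltr_pdivrMr // mulrC.
by rewrite ltNge q_le.
Qed.

(** * The absorption time in terms of the spectrum *)

Theorem theorem5p2 (R : realType) (d : nat)
    (dsp : measure_display) (Omega : measurableType dsp)
    (Pr : probability Omega R)
    (X : nat -> Omega -> 'I_d.+1) (m0 : 'rV[R]_d.+1) (P : 'M[R]_d.+1)
    (X_chain : markov_chain Pr X m0 P)
    (d_absorbing : absorbing P ord_max)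
    (d_accessible : forall i : 'I_d.+1, i != ord_max -> accessible P i ord_max)
    (theta : 'I_d.+1 -> R[i])
    (theta_eigenvalues : nonunit_eigenvalues P theta) :
  let T := hitting_time X ord_max in
  [/\ forall t : nat,
        (fine (Pr [set w | time_le (T w) t]))%:C =
        \sum_(k < d.+1) a_coef m0 P theta k *
          \sum_(j < d.+1 | (k <= j)%N) (Phat theta ^+ t) ord0 j,
      forall u : R[i], `|u| < 1 ->
        cexpectation Pr (fun w => time_pow u (T w)) =
        \sum_(k < d.+1) a_coef m0 P theta k *
          \prod_(j < d.+1 | (j < k)%N)
             ((1 - theta j) * u / (1 - theta j * u))
    & (forall i : 'I_d.+1, 0 <= theta i) ->
      (forall i j : 'I_d.+1, (i <= j)%N -> theta i <= theta j) ->
      (forall k : nat, (k <= d)%N -> mx_nonneg (spectral_poly P theta k)) ->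
      [/\ forall k : 'I_d.+1, 0 <= a_coef m0 P theta k,
          \sum_(k < d.+1) a_coef m0 P theta k = 1
        & has_pmf Pr T
            (mixture_pmf (fun k : 'I_d.+1 => complex.Re (a_coef m0 P theta k))
               (fun k : 'I_d.+1 => conv_geometric_pmf theta k))]].
Proof.
move=> T; have [P_stoch _ _ _] := X_chain.
pose L k := map_mx (real_complex R) m0 *m Q P theta k.
pose a := a_coef m0 P theta.
have L_mulmx k : (k <= d)%N -> L k *m map_mx (real_complex R) P =
    theta (inord k) *: L k + (1 - theta (inord k)) *: L k.+1.
  exact: spectral_row_mulmx.
have a_sum k : (k <= d)%N -> \sum_(j < k.+1) a j = L k ord0 ord_max.
  exact: a_coef_partial_sum.
have L0 : L 0 = map_mx (real_complex R) m0 by exact: spectral_row0.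
pose F t := fine (Pr [set w | time_le (T w) t]).
pose p n := fine (Pr [set w | T w = Some n]).
have mT n : measurable [set w | T w = Some n].
  exact: (measurable_hitting_time X_chain).
have F_sum t : F t = \sum_(n < t.+1) p n by exact: cdf_pmf.
have F_row t : (F t)%:C = (L 0 *m map_mx (real_complex R) P ^+ t) ord0 ord_max.
  rewrite /F (absorption_cdf X_chain d_absorbing) L0 -rmorphXn /=.
  by rewrite -map_mxM [RHS]mxE.
have F_birth t : (F t)%:C = \sum_(k < d.+1) a k * birth_cdf theta k t.
  rewrite F_row (duality_exp theta_eigenvalues L_mulmx).
  rewrite (sum_tail_duality a_sum) summxE.
  by apply: eq_bigr => i _; rewrite mxE.
split=> [//|u u_lt1|theta_ge0 theta_le spectral_ge0].
  (* Both sides are within a multiple of |u|^(N + 1) of the partial sum S. *)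
  have [K K_ge0 K_bound] :=
    pgf_error_bound theta_eigenvalues P_stoch L_mulmx a_sum u_lt1.
  set Z := cexpectation _ _; set G := \sum_(k < d.+1) _.
  have r_E := norm_complexE u; set r := complex.Re `|u| in r_E.
  have r_bound : 0 <= r < 1 by rewrite -ler0c -ltcR -r_E normr_ge0.
  apply/eqP; rewrite -subr_eq0 -normr_eq0 norm_complexE fmorph_eq0; apply/eqP.
  apply: (@geometric_bound_eq0 _ _ ((2 + K) * r) r) => // [|N].
    by rewrite -ler0c -norm_complexE.
  rewrite -mulrA -exprS -lecR -norm_complexE rmorphM rmorphXn /= -r_E.
  pose S := \sum_(n < N.+1) u ^+ n * (p n)%:C.
  rewrite -(subrKA S) (le_trans (ler_normD _ _)) // rmorphD rmorph_nat mulrDl.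
  apply: lerD; first exact: cexpectation_pow_approx.
  move: (K_bound N); congr (`|_ - _| <= _); apply: eq_bigr => n _.
  congr (_ * _); rewrite -!F_row; case: (n : nat) => [|n'].
    by rewrite F_sum big_ord1 subr0.
  by rewrite -!F_row !F_sum big_ord_recr /= -rmorphB addrAC subrr add0r.
have L_ge0 k j : (k <= d)%N -> 0 <= L k ord0 j.
  move=> le_kd; apply: spectral_row_ge0 => //; last exact: spectral_ge0.
  exact: (initial_ge0 X_chain).
have L_sum k : (k <= d)%N -> \sum_j L k ord0 j = 1.
  move=> le_kd; apply: spectral_row_sum => //.
  exact: (initial_sum X_chain).
have a_ge0 k : (k <= d)%N -> 0 <= a k.
  exact: (mixture_weight_ge0 theta_eigenvalues P_stoch L_mulmx a_sum theta_le
    L_ge0 d_absorbing).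
have a_total : \sum_(k < d.+1) a k = 1.
  exact: (mixture_weight_sum theta_eigenvalues P_stoch L_mulmx a_sum
    L_ge0 L_sum d_absorbing d_accessible).
have theta_real i : theta i \is Num.real by exact: ger0_real.
have a_real (k : 'I_d.+1) : (complex.Re (a k))%:C = a k.
  by rewrite RRe_real // ger0_real // a_ge0 // -ltnS.
set g := mixture_pmf _ _.
have F_mixture t : F t = \sum_(n < t.+1) g n.
  apply: complexI; rewrite F_birth rmorph_sum /=.
  under [RHS]eq_bigr do rewrite /g /mixture_pmf rmorph_sum /=.
  rewrite exchange_big /=; apply: eq_bigr => k _.
  have le_kd : (k <= d)%N by rewrite -ltnS.
  rewrite -(birth_cdf_conv_geometric _ theta_eigenvalues) // rmorph_sum.
  rewrite mulr_sumr; apply: eq_bigr => n _.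
  by rewrite rmorphM /= a_real.
have p_mixture n : p n = g n.
  case: n => [|n].
    by have := F_mixture 0; rewrite F_sum !big_ord1.
  have := F_mixture n.+1; rewrite F_sum !(big_ord_recr n.+1) /=.
  by rewrite -F_sum -F_mixture => /addrI.
split=> // [k|]; first by apply: a_ge0; rewrite -ltnS.
split=> [n|]; first by rewrite -p_mixture fineK // prob_fin_num.
(* With q = Pr (T = oo), N q is at most the sum of Pr (T > t) over t < N, which is
   bounded by a mixture of expected birth times; so q = 0. *)
have mNone : measurable [set w | T w = None].
  exact: (measurable_fibre mT (fun s => s = None)).
rewrite -[LHS]fineK ?prob_fin_num //; congr EFin.
pose B : R[i] := \sum_(k < d.+1) a k * \sum_(j < k) (1 - theta (inord j))^-1.
apply: (@linear_bound_eq0 _ _ (complex.Re B)) => [|N]; first exact: fine_ge0.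
set q := fine _.
have q_le t : q <= 1 - F t.
  rewrite lerBrDr /q /F -fineD ?prob_fin_num //; last exact: measurable_time_le.
  rewrite -measureU //; last 2 first.
  - exact: measurable_time_le.
  - by rewrite -subset0 => w /= [->].
  rewrite -[leRHS]/(fine 1%E) fine_le ?prob_fin_num //; last first.
    by apply: probability_le1; apply: measurableU => //; exact: measurable_time_le.
  by apply: measurableU => //; exact: measurable_time_le.
have qN_le : (q * N%:R)%:C <= B.
  apply: (@le_trans _ _ (\sum_(t < N) (1 - F t))%:C).
    rewrite lecR mulr_natr -[X in _ *+ X]card_ord -sumr_const.
    by apply: ler_sum => t _.
  rewrite rmorph_sum /=.
  have -> : \sum_(t < N) (1 - F t)%:C =
      \sum_(k < d.+1) a k * \sum_(t < N) (1 - birth_cdf theta k t).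
    under [RHS]eq_bigr do rewrite mulr_sumr.
    rewrite exchange_big /=; apply: eq_bigr => t _.
    rewrite rmorphB rmorph1 /= F_birth -{1}a_total -sumrB.
    by apply: eq_bigr => k _; rewrite mulrBr mulr1.
  apply: ler_sum => k _; have le_kd : (k <= d)%N by rewrite -ltnS.
  rewrite ler_wpM2l ?a_ge0 //.
  exact: (birth_survival_sum_bound theta_eigenvalues).
by move: qN_le; rewrite lecE => /andP[].
Qed.
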